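(* Let $1 \le s \le r$ be fixed integers, let $\alpha \in (0,1)$ be fixed, and let $n \ge r$. Let $H_1, H_2, \ldots$ be independent, each uniformly distributed over the $r$-element subsets of $[n] = \{1, \ldots, n\}$. An $s$-element subset $S \subseteq [n]$ is said to be collected by time $k$ if $S \subseteq H_t$ for some $t \le k$. Let $T^{(r,s)}_\alpha$ be the smallest $k$ such that at least $(1-\alpha)\binom{n}{s}$ distinct $s$-element subsets of $[n]$ have been collected by time $k$. Then, as $n \to \infty$, \[ \mathbb{E}\, T^{(r,s)}_\alpha = \frac{\binom{n}{s}\log\left(\frac{1}{\alpha}\right)}{\binom{r}{s}}\,(1+o(1)). \]
   Context: In each round $t$ one draws $r$ distinct coupons uniformly at random (without replacement) from $[n]$, independently across rounds; all $s$-subsets of the drawn $r$-set are marked as collected. *)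

(* Defs.v *)
From HB Require Import structures.
From mathcomp Require Import all_boot all_order all_algebra.
From mathcomp Require Import all_classical all_reals all_analysis.
Set Implicit Arguments. Unset Strict Implicit. Unset Printing Implicit Defensive.
Import Order.TTheory GRing.Theory Num.Theory.
Local Open Scope ring_scope.

(* Coupons are [n] = 'I_n.  A history of the first k rounds is a finite function
   f : 'I_k -> {set 'I_n}; it is a legal outcome iff every f t is an r-subset.
   Since the H_t are i.i.d. uniform over r-subsets, the law of (H_1,...,H_k) is
   the uniform distribution over legal histories of length k. *)

Definition rsets (n r : nat) : {set {set 'I_n}} := [set H : {set 'I_n} | #|H| == r].

Definition histories (n r k : nat) : {set {ffun 'I_k -> {set 'I_n}}} :=
  [set f : {ffun 'I_k -> {set 'I_n}} | [forall t, f t \in rsets n r]].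

(* the s-subsets collected by time j (i.e. in rounds t < j, 0-indexed) *)
Definition collected (n s k : nat) (f : {ffun 'I_k -> {set 'I_n}}) (j : nat)
  : {set {set 'I_n}} :=
  [set S : {set 'I_n} | (#|S| == s) && [exists t : 'I_k, (t < j)%N && (S \subset f t)]].

Definition reached (R : realType) (alpha : R) (n s k : nat)
  (f : {ffun 'I_k -> {set 'I_n}}) (j : nat) : bool :=
  (1 - alpha) * ('C(n, s))%:R <= (#|collected s f j|)%:R.

(* P(T^{(r,s)}_alpha = k): the event depends only on H_1..H_k *)
Definition prob_T_eq (R : realType) (alpha : R) (n r s k : nat) : R :=
  (#|[set f in histories n r k |
        reached alpha s f k && ~~ reached alpha s f k.-1]|)%:R
  / (#|histories n r k|)%:R.

Definition expect_T (R : realType) (alpha : R) (n r s : nat) : \bar R :=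
  (\sum_(0 <= k <oo) ((k%:R * prob_T_eq alpha n r s k)%:E))%E.

(* Main.v *)
(* Let u_k be the fraction of s-subsets not yet collected at time k and
   p = C(r,s) / C(n,s).  Each round uncovers a fixed s-subset with probability
   p, so u decreases on average by p u; as one round collects at most C(r,s)
   subsets, a decrement is at most p, and while u > alpha the conditional drift
   of ln u lies between - p / (1 - p / alpha) and - p.  At the stopping time
   alpha - p <= u <= alpha.  Optional stopping for ln u then gives
     (1 - p / alpha) ln (1 / alpha) / p <= E T <= - ln (alpha - p) / p,
   and p tends to 0; no variance estimate is needed. *)
Require Import Defs.
From HB Require Import structures.
From mathcomp Require Import all_boot all_order all_algebra.
From mathcomp Require Import all_classical all_reals all_analysis.
From mathcomp Require Import ring lra.
Import Order.TTheory GRing.Theory Num.Theory numFieldNormedType.Exports.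
Local Open Scope classical_set_scope.
Local Open Scope ring_scope.
Set Implicit Arguments.
Unset Strict Implicit.
Unset Printing Implicit Defensive.

(** * Counting [r]-sets above given [s]-sets *)

Lemma card_supersets (n r s : nat) (S : {set 'I_n}) : (r <= n)%N -> #|S| = s ->
  #|[set H in rsets n r | S \subset H]%SET| = 'C(n - s, n - r).
Proof.
(* Complementation turns the supersets of [S] into (n - r)-subsets of its complement. The form C(n -
   s, n - r) is 0 for r < s, as it should be, where a truncated r - s would give 1. *)
move=> rn cS; have -> : (n - s = #|~: S|)%N.
  by rewrite cardsCs finset.setCK card_ord cS.
rewrite -cards_draws -(card_imset _ (@finset.setC_inj 'I_n)).
congr #|pred_of_set _|; apply/setP => H; rewrite !inE.
apply/andP/imsetP => [[/eqP cH SH]|[G /[!inE] /andP[SG /eqP cG] ->]].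
  exists (finset.setC H); last by rewrite finset.setCK.
  by rewrite !inE finset.setCS SH cardsCs finset.setCK card_ord cH eqxx.
rewrite -finset.setCS finset.setCK; split=> //.
by rewrite cardsCs finset.setCK card_ord cG subKn.
Qed.

(** Exchange of summation: each [S] is counted once per [r]-set above it. With [A] the uncollected
    subsets, this gives the mean gain of one round. *)
Lemma sum_card_subsets (n r s : nat) (A : {set {set 'I_n}}) : (r <= n)%N ->
  {in A, forall S : {set 'I_n}, #|S| = s} ->
  (\sum_(H in rsets n r) #|[set S in A | S \subset H]%SET|
   = #|A| * 'C(n - s, n - r))%N.
Proof.
move=> rn As.
under eq_bigr do rewrite -sum1dep_card.
rewrite (exchange_big_dep (mem A)) /=; last by move=> H S _ /andP[].
rewrite -sum_nat_const; apply: eq_bigr => S AS.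
rewrite -(card_supersets rn (As _ AS)) -sum1dep_card.
by apply: eq_bigl => H; rewrite AS.
Qed.

Lemma card_rsets (n s : nat) : #|rsets n s| = 'C(n, s).
Proof. by rewrite card_draws card_ord. Qed.

(* Double counting of the pairs S \subset H. *)
Lemma mul_bin_supersets (n r s : nat) : (r <= n)%N ->
  ('C(n, r) * 'C(r, s) = 'C(n, s) * 'C(n - s, n - r))%N.
Proof.
move=> rn; rewrite -(card_rsets n s).
rewrite -(@sum_card_subsets _ r s) //; last by move=> S; rewrite inE => /eqP.
rewrite -(card_rsets n r) -sum_nat_const.
apply: eq_bigr => H; rewrite !inE => /eqP <-.
by rewrite -cards_draws; apply: eq_card => S; rewrite !inE andbC.
Qed.

(** * Histories extended by one round *)

Definition snoc (k : nat) (T : Type) (f : {ffun 'I_k -> T}) (x : T) :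
  {ffun 'I_k.+1 -> T} := [ffun i => oapp f x (unlift ord_max i)].

Lemma snoc_lift (k : nat) (T : Type) (f : {ffun 'I_k -> T}) (x : T) i :
  snoc f x (lift ord_max i) = f i.
Proof. by rewrite ffunE liftK. Qed.

Lemma snoc_max (k : nat) (T : Type) (f : {ffun 'I_k -> T}) (x : T) :
  snoc f x ord_max = x.
Proof. by rewrite ffunE unlift_none. Qed.

(** [snoc] is a bijection from pairs (legal history, [r]-set) onto the longer legal histories; this
    is where independence of the last round enters. *)
Lemma sum_histories_recr (V : nmodType) (n r k : nat)
    (F : {ffun 'I_k.+1 -> {set 'I_n}} -> V) :
  \sum_(f in histories n r k.+1) F f =
  \sum_(f in histories n r k) \sum_(H in rsets n r) F (snoc f H).
Proof.
rewrite pair_big; rewrite (reindex (fun fH => snoc fH.1 fH.2)) /=.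
  apply: eq_bigl => -[f H] /=; rewrite !inE.
  apply/forallP/andP => [fH|[/forallP fr Hr] i].
    split; last by have := fH ord_max; rewrite snoc_max inE.
    by apply/forallP => i; have := fH (lift ord_max i); rewrite snoc_lift.
  case: (unliftP ord_max i) => [j|] ->; first by rewrite snoc_lift.
  by rewrite snoc_max inE.
apply: onW_bij => /=.
apply: (@Bijective _ _ _ (fun f : {ffun 'I_k.+1 -> {set 'I_n}} =>
  ([ffun i => f (lift ord_max i)], f ord_max))).
  move=> [f H] /=; rewrite snoc_max; congr pair.
  by apply/ffunP => i; rewrite ffunE snoc_lift.
move=> f; apply/ffunP => i.
by case: (unliftP ord_max i) => [j|] ->; rewrite ?snoc_lift ?snoc_max ?ffunE.
Qed.

Lemma card_histories (n r k : nat) : #|histories n r k| = (#|rsets n r| ^ k)%N.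
Proof.
rewrite -[X in (_ ^ X)%N]card_ord -card_ffun_on; apply: eq_card => f.
by rewrite inE; apply/forallP/ffun_onP.
Qed.

(** * Collected and uncollected subsets after one more round *)

Definition uncollected (n s k : nat) (f : {ffun 'I_k -> {set 'I_n}}) (j : nat) :
  {set {set 'I_n}} := (rsets n s :\: collected s f j)%SET.

Lemma card_uncollected (n s k : nat) (f : {ffun 'I_k -> {set 'I_n}}) (j : nat) :
  (#|collected s f j| + #|uncollected s f j| = 'C(n, s))%N.
Proof.
rewrite -card_rsets -(cardsID (collected s f j) (rsets n s)); congr addn.
by apply: eq_card => S; rewrite !inE; case: eqP.
Qed.

(** The added round has index [k], which the strict test t < k leaves out. *)
Lemma collected_snoc (n s k : nat) (f : {ffun 'I_k -> {set 'I_n}}) (H : {set 'I_n}) :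
  collected s (snoc f H) k = collected s f k.
Proof.
apply/setP => S; rewrite !inE; congr andb; apply/existsP/existsP => -[i].
  case: (unliftP ord_max i) => [j|] ->; last by rewrite ltnn.
  by rewrite snoc_lift lift_max => /andP[jk Sf]; exists j; rewrite jk.
by move=> /andP[ik Sf]; exists (lift ord_max i); rewrite snoc_lift lift_max ik.
Qed.

Lemma uncollected_snocS (n s k : nat) (f : {ffun 'I_k -> {set 'I_n}}) (H : {set 'I_n}) :
  uncollected s (snoc f H) k.+1 =
  (uncollected s f k :\: [set S in uncollected s f k | S \subset H])%SET.
Proof.
apply/setP => S.
have ES : [exists t : 'I_k.+1, (t < k.+1)%N && (S \subset snoc f H t)] =
    [exists t : 'I_k, (t < k)%N && (S \subset f t)] || (S \subset H).
  apply/existsP/orP => [[i /andP[_]]|[/existsP[i /andP[_ Si]]|SH]].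
  - case: (unliftP ord_max i) => [j|] ->; last by rewrite snoc_max; right.
    by rewrite snoc_lift => Sj; left; apply/existsP; exists j; rewrite Sj ltn_ord.
  - by exists (lift ord_max i); rewrite snoc_lift Si ltn_ord.
  - by exists ord_max; rewrite snoc_max SH ltn_ord.
by rewrite !inE ES; case: (#|S| == s); case: [exists t, _]; case: (S \subset H).
Qed.

Lemma collected_le (n s k : nat) (f : {ffun 'I_k -> {set 'I_n}}) (i j : nat) :
  (i <= j)%N -> (#|collected s f i| <= #|collected s f j|)%N.
Proof.
move=> ij; apply/subset_leq_card/fintype.subsetP => S; rewrite !inE => /andP[-> /=].
move=> /existsP[t /andP[ti St]]; apply/existsP; exists t.
by rewrite (leq_trans ti ij).
Qed.

(** * Expectation of a stopping time from its tail, and optional stopping for real sequences *)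

Lemma sum_mul_succ_drop (R : realType) (a P : nat -> R) :
  P 0%N = 0 -> (forall k, P k.+1 = a k - a k.+1) ->
  forall K, \sum_(0 <= k < K.+1) k%:R * P k = \sum_(0 <= k < K) a k - K%:R * a K.
Proof.
move=> P0 PS; elim=> [|K IH].
  by rewrite big_nat1 big_nil P0 mulr0 mul0r subr0.
rewrite big_nat_recr //= IH PS [in RHS]big_nat_recr //= -natr1; ring.
Qed.

(* Abel summation: the boundary term [K * a K] is absorbed by comparing with the
   partial sum up to a fixed [J] before letting [K] go to infinity. *)
Lemma expectation_bounds (R : realType) (a P : nat -> R) (c U : R) :
  a 0%N = 1 -> (forall k, 0 <= a k) -> (forall k, 0 <= P k) ->
  P 0%N = 0 -> (forall k, P k.+1 = a k - a k.+1) -> 0 <= c ->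
  (forall K, c * (1 - a K) <= \sum_(0 <= k < K) a k <= U) ->
  (c%:E <= \sum_(0 <= k <oo) (k%:R * P k)%:E <= U%:E)%E.
Proof.
move=> a0 a_ge0 P_ge0 P0 PS c_ge0 aB.
have kP0 k : (0 <= (k%:R * P k)%:E)%E by rewrite lee_fin mulr_ge0.
set E := (X in (_ <= X <= _)%E).
have E_ge K : ((\sum_(0 <= k < K) a k - K%:R * a K)%:E <= E)%E.
  rewrite -(sum_mul_succ_drop P0 PS) -sumEFin.
  by apply: nneseries_lim_ge => *; exact: kP0.
have EU : (E <= U%:E)%E.
  apply: lime_le; first exact: is_cvg_nneseries.
  apply: nearW => -[|K]; rewrite sumEFin lee_fin.
    rewrite big_geq //; have /andP[_] := aB 0%N.
    by rewrite big_geq.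
  rewrite (sum_mul_succ_drop P0 PS); have /andP[_] := aB K.
  by apply: le_trans; rewrite lerBlDr lerDl mulr_ge0.
rewrite EU andbT.
have Efin : E \is a fin_num.
  by rewrite ge0_fin_numE ?(le_lt_trans EU) ?ltry//; apply: nneseries_ge0 => *; exact: kP0.
(* As [a] is nonincreasing, every [a k] with J <= k < K is at least [a K], so the left side is at
   most the same expression with [K] for [J]. *)
have Esum J K : (J <= K)%N -> \sum_(0 <= k < J) a k - J%:R * a K <= fine E.
  move=> JK; rewrite -lee_fin fineK//; apply: le_trans (E_ge K); rewrite lee_fin.
  elim: K JK => [|K IH]; first by rewrite leqn0 => /eqP ->.
  rewrite leq_eqVlt => /predU1P[->//|]; rewrite ltnS => JK; have := IH JK.
  have JKR : (J%:R : R) <= K%:R by rewrite ler_nat.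
  rewrite big_nat_recr //= -natr1; have := P_ge0 K.+1; rewrite PS; nra.
(* The partial sums of [a] are bounded by [U], so the series converges and its terms vanish. *)
have a_cvg0 : a @ \oo --> 0.
  apply: cvg_series_cvg_0; apply: nondecreasing_is_cvgn.
    by apply/nondecreasing_seqP => k; rewrite /series/= big_nat_recr //= lerDl.
  by exists U => _ [K _ <-]; have /andP[] := aB K.
have Esup J : \sum_(0 <= k < J) a k <= fine E.
  have cv : (fun K => \sum_(0 <= k < J) a k - J%:R * a K) @ \oo -->
     \sum_(0 <= k < J) a k - J%:R * 0.
    by apply: cvgB; [exact: cvg_cst | apply: cvgM => //; exact: cvg_cst].
  rewrite mulr0 subr0 in cv.
  rewrite -(cvg_lim _ cv) //; apply: limr_le; first exact: cvgP cv.
  by near=> K; apply: Esum; near: K; exact: nbhs_infty_ge.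
rewrite -(fineK Efin) lee_fin.
have cv : (fun K => c * (1 - a K)) @ \oo --> c * (1 - 0).
  by apply: cvgM; [exact: cvg_cst | apply: cvgB => //; exact: cvg_cst].
rewrite subr0 mulr1 in cv.
rewrite -(cvg_lim _ cv) //; apply: limr_le; first exact: cvgP cv.
by near=> K; apply: le_trans (Esup K); have /andP[] := aB K.
Unshelve. all: by end_near. Qed.

(* [a] is the tail of a stopping time, [G] and [B] the contributions of the
   running and of the just stopped paths to the mean of a potential. *)
Lemma stopped_potential_bounds (R : realType) (a G B : nat -> R) (p q lo hi : R) :
  a 0%N = 1 -> G 0%N = 0 ->
  (forall k, - q * a k <= G k.+1 + B k.+1 - G k <= - p * a k) ->
  (forall k, lo * (a k - a k.+1) <= B k.+1 <= hi * (a k - a k.+1)) ->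
  (forall k, lo * a k <= G k <= 0) ->
  forall K, p * \sum_(0 <= k < K) a k <= - lo /\
            - hi * (1 - a K) <= q * \sum_(0 <= k < K) a k.
Proof.
move=> a0 G0 step stop run K.
(* Strengthened for induction: the drifts telescope to [G K] plus the stopped contributions, which
   have total mass 1 - [a K] and lie between [lo] and [hi] times it. The bounds on [G K] then
   finish. *)
suff [h1 h2] : p * \sum_(0 <= k < K) a k <= - G K - lo * (1 - a K) /\
            - G K - hi * (1 - a K) <= q * \sum_(0 <= k < K) a k.
  have := run K; split; lra.
elim: K => [|K [IH1 IH2]]; first by rewrite big_geq // a0 G0; split; lra.
rewrite big_nat_recr //= !mulrDr; have := step K; have := stop K; split; lra.
Qed.

(** * Averages over finite sets *)

Definition avg (R : realType) (T : finType) (A : {set T}) (F : T -> R) : R :=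
  (\sum_(x in A) F x) / #|A|%:R.

Lemma avg_le (R : realType) (T : finType) (A : {set T}) (F G : T -> R) :
  {in A, forall x, F x <= G x} -> avg A F <= avg A G.
Proof. by move=> FG; rewrite ler_wpM2r ?invr_ge0 ?ler0n// ler_sum. Qed.

Lemma eq_avg (R : realType) (T : finType) (A : {set T}) (F G : T -> R) :
  {in A, F =1 G} -> avg A F = avg A G.
Proof. by move=> FG; rewrite /avg (eq_bigr _ FG). Qed.

Lemma avgD (R : realType) (T : finType) (A : {set T}) (F G : T -> R) :
  avg A (fun x => F x + G x) = avg A F + avg A G.
Proof. by rewrite /avg big_split mulrDl. Qed.

Lemma avgB (R : realType) (T : finType) (A : {set T}) (F G : T -> R) :
  avg A (fun x => F x - G x) = avg A F - avg A G.
Proof. by rewrite /avg sumrB mulrBl. Qed.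

Lemma avgZ (R : realType) (T : finType) (A : {set T}) (c : R) (F : T -> R) :
  avg A (fun x => c * F x) = c * avg A F.
Proof. by rewrite /avg -mulr_sumr mulrA. Qed.

Lemma avg_cst (R : realType) (T : finType) (A : {set T}) (c : R) :
  (0 < #|A|)%N -> avg A (fun=> c) = c.
Proof.
move=> A0; rewrite /avg sumr_const -[c *+ _]mulr_natr mulfK//.
by rewrite pnatr_eq0 -lt0n.
Qed.

Lemma avg_ge0 (R : realType) (T : finType) (A : {set T}) (F : T -> R) :
  (forall x, 0 <= F x) -> 0 <= avg A F.
Proof. by move=> F0; rewrite divr_ge0 ?sumr_ge0 ?ler0n. Qed.

(** Tower property: the inner average is the conditional expectation given the first [k] rounds. *)
Lemma avg_histories_recr (R : realType) (n r k : nat)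
    (F : {ffun 'I_k.+1 -> {set 'I_n}} -> R) :
  avg (histories n r k.+1) F =
  avg (histories n r k) (fun f => avg (rsets n r) (fun H => F (snoc f H))).
Proof.
rewrite /avg sum_histories_recr -mulr_suml -mulrA -invfM !card_histories.
by rewrite expnS natrM.
Qed.

(** * Drift of the logarithmic potential in one round *)

Lemma lnB_bounds (R : realType) (N c d p alpha : R) :
  0 < N -> 0 <= d -> d <= p * N -> alpha * N < c -> p < alpha -> 0 < alpha ->
  - (1 - p / alpha)^-1 * (d / c) <= ln ((c - d) / N) - ln (c / N) <= - (d / c).
Proof.
move=> N0 d0 dp Nc pa a0.
have c0 : 0 < c by apply: lt_trans Nc; rewrite mulr_gt0.
have pN : p * N < alpha * N by rewrite ltr_pM2r.
have p0 : 0 <= p by have := le_trans d0 dp; rewrite pmulr_lge0.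
have pa1 : p / alpha < 1 by rewrite ltr_pdivrMr// mul1r.
have x0 : 0 <= d / c by rewrite divr_ge0 // ltW.
(* The decrement is ln (1 - x) with x = d / c. Both bounds are kept linear in x, so that averaging
   over the round needs only the mean of [d]. *)
have xpa : d / c <= p / alpha.
  rewrite ler_pdivrMr// mulrAC ler_pdivlMr//.
  apply: (@le_trans _ _ (p * N * alpha)); first by rewrite ler_wpM2r// ltW.
  by rewrite -mulrA [N * _]mulrC ler_wpM2l// ltW.
have x1 : d / c < 1 by apply: le_lt_trans xpa pa1.
have -> : ln ((c - d) / N) - ln (c / N) = ln (1 - d / c).
  rewrite -ln_div ?posrE ?divr_gt0 ?subr_gt0 ?(le_lt_trans dp) ?(lt_trans pN)//.
  by congr ln; field; rewrite !gt_eqF.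
apply/andP; split; last by apply: le_ln1Dx; lra.
move: (d / c) x0 x1 xpa => x x0 x1 xpa.
have y0 : 0 <= x / (1 - x) by rewrite divr_ge0 //; lra.
(* Passing to the reciprocal lets the upper bound ln (1 + y) <= y serve as a lower bound. *)
have -> : ln (1 - x) = - ln (1 + x / (1 - x)).
  rewrite -lnV ?posrE ?ltr_wpDr//.
  by congr ln; field; rewrite gt_eqF //; lra.
rewrite mulNr lerN2.
apply: (@le_trans _ _ (x / (1 - x))).
  apply: le_ln1Dx; apply: lt_le_trans y0; lra.
by rewrite mulrC ler_wpM2r// lef_pV2 ?posrE; lra.
Qed.

Lemma reached_mono (R : realType) (alpha : R) (n s k : nat)
    (f : {ffun 'I_k -> {set 'I_n}}) (i j : nat) :
  (i <= j)%N -> reached alpha s f i -> reached alpha s f j.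
Proof.
by move=> ij /le_trans; apply; rewrite ler_nat collected_le.
Qed.

Lemma reachedNE (R : realType) (alpha : R) (n s k : nat)
    (f : {ffun 'I_k -> {set 'I_n}}) (j : nat) :
  ~~ reached alpha s f j = (alpha * 'C(n, s)%:R < #|uncollected s f j|%:R).
Proof.
rewrite /reached -ltNge -(card_uncollected s f j) natrD.
by apply/idP/idP; lra.
Qed.

Lemma reached_snoc (R : realType) (alpha : R) (n s k : nat)
    (f : {ffun 'I_k -> {set 'I_n}}) (H : {set 'I_n}) :
  reached alpha s (snoc f H) k = reached alpha s f k.
Proof. by rewrite /reached collected_snoc. Qed.

Definition newly_collected (n s k : nat) (f : {ffun 'I_k -> {set 'I_n}}) (H : {set 'I_n}) :
  {set {set 'I_n}} := [set S in uncollected s f k | S \subset H]%SET.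

Lemma card_uncollected_snoc (R : realType) (n s k : nat)
    (f : {ffun 'I_k -> {set 'I_n}}) (H : {set 'I_n}) :
  #|uncollected s (snoc f H) k.+1|%:R =
  #|uncollected s f k|%:R - #|newly_collected s f H|%:R :> R.
Proof.
have sub : newly_collected s f H \subset uncollected s f k.
  by apply/fintype.subsetP => S; rewrite inE => /andP[].
by rewrite uncollected_snocS cardsDS// natrB// subset_leq_card.
Qed.

Lemma card_newly_collected_le (n r s k : nat) (f : {ffun 'I_k -> {set 'I_n}}) (H : {set 'I_n}) :
  H \in rsets n r -> (#|newly_collected s f H| <= 'C(r, s))%N.
Proof.
rewrite inE => /eqP <-; rewrite -cards_draws.
apply/subset_leq_card/fintype.subsetP => S; rewrite !inE => /andP[/andP[_ ->] ->].
by [].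
Qed.

(** Every uncollected subset lies in the same fraction C(r, s) / C(n, s) of the [r]-sets, by
    [mul_bin_supersets]; linearity does the rest. *)
Lemma avg_card_newly_collected (R : realType) (n r s k : nat) (f : {ffun 'I_k -> {set 'I_n}}) :
  (s <= r)%N -> (r <= n)%N ->
  avg (rsets n r) (fun H => #|newly_collected s f H|%:R) =
  'C(r, s)%:R / 'C(n, s)%:R * #|uncollected s f k|%:R :> R.
Proof.
move=> sr rn.
have Us : {in uncollected s f k, forall S : {set 'I_n}, #|S| = s}.
  by move=> S; rewrite !inE => /andP[_ /eqP].
rewrite /avg -natr_sum (sum_card_subsets rn Us) card_rsets natrM.
have h0 : ('C(n, r)%:R : R) != 0 by rewrite pnatr_eq0 -lt0n bin_gt0.
have N0 : ('C(n, s)%:R : R) != 0 by rewrite pnatr_eq0 -lt0n bin_gt0 (leq_trans sr).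
have /(congr1 (fun m => m%:R : R)) := mul_bin_supersets s rn.
rewrite !natrM => /(canRL (mulKf h0)) ->; field.
by rewrite h0 N0.
Qed.

(** The convention ln 0 = 0 is harmless: for p < alpha, a fraction of at least alpha - p is left
    through the stopping round, and later histories get weight 0. *)
Definition potential (R : realType) (n s k : nat) (f : {ffun 'I_k -> {set 'I_n}}) : R :=
  ln (#|uncollected s f k|%:R / 'C(n, s)%:R).

Lemma avg_potential_drift (R : realType) (n r s k : nat) (alpha p : R)
    (f : {ffun 'I_k -> {set 'I_n}}) :
  (s <= r)%N -> (r <= n)%N -> p = 'C(r, s)%:R / 'C(n, s)%:R ->
  0 < alpha -> p < alpha -> ~~ reached alpha s f k ->
  - ((1 - p / alpha)^-1 * p) <=
    avg (rsets n r) (fun H => potential R s (snoc f H)) - potential R s f <= - p.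
Proof.
move=> sr rn pE alpha0 pa; rewrite reachedNE => cN.
have N0 : 0 < ('C(n, s)%:R : R) by rewrite ltr0n bin_gt0 (leq_trans sr).
have h0 : (0 < #|rsets n r|)%N by rewrite card_rsets bin_gt0.
have c0 : 0 < (#|uncollected s f k|%:R : R) by apply: lt_trans cN; rewrite mulr_gt0.
(* The mean relative loss is exactly [p], whatever the history. *)
have davg : avg (rsets n r) (fun H => #|newly_collected s f H|%:R / #|uncollected s f k|%:R) = p.
  under eq_avg do rewrite mulrC.
  by rewrite avgZ avg_card_newly_collected// -pE mulrC mulfK// gt_eqF.
have -> : avg (rsets n r) (fun H => potential R s (snoc f H)) - potential R s f =
    avg (rsets n r) (fun H => potential R s (snoc f H) - potential R s f).
  by rewrite avgB (avg_cst _ h0).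
have step H : H \in rsets n r ->
    - (1 - p / alpha)^-1 * (#|newly_collected s f H|%:R / #|uncollected s f k|%:R) <=
    potential R s (snoc f H) - potential R s f <=
    - (#|newly_collected s f H|%:R / #|uncollected s f k|%:R).
  move=> Hr; rewrite /potential card_uncollected_snoc.
  apply: lnB_bounds => //.
  by rewrite pE divfK ?gt_eqF// ler_nat (card_newly_collected_le _ _ Hr).
apply/andP; split.
  have -> : - ((1 - p / alpha)^-1 * p) = avg (rsets n r) (fun H =>
      - (1 - p / alpha)^-1 * (#|newly_collected s f H|%:R / #|uncollected s f k|%:R)).
    by rewrite avgZ davg mulNr.
  by apply: avg_le => H Hr; have /andP[] := step H Hr.
have -> : - p = avg (rsets n r) (fun H =>
    -1 * (#|newly_collected s f H|%:R / #|uncollected s f k|%:R)).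
  by rewrite avgZ davg mulN1r.
by apply: avg_le => H Hr; rewrite mulN1r; have /andP[] := step H Hr.
Qed.

(** * Running and stopping paths *)

Definition running (R : realType) (alpha : R) (n s k : nat)
  (f : {ffun 'I_k -> {set 'I_n}}) (j : nat) : R := (~~ reached alpha s f j)%:R.

Definition stopping (R : realType) (alpha : R) (n s k : nat)
    (f : {ffun 'I_k -> {set 'I_n}}) : R :=
  (reached alpha s f k && ~~ reached alpha s f k.-1)%:R.

(** This is P(T > k), because [reached] is monotone in time. *)
Definition tail (R : realType) (alpha : R) (n r s k : nat) : R :=
  avg (histories n r k) (fun f => running alpha s f k).

Lemma stoppingS (R : realType) (alpha : R) (n s k : nat)
    (f : {ffun 'I_k.+1 -> {set 'I_n}}) :
  stopping alpha s f = running alpha s f k - running alpha s f k.+1.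
Proof.
rewrite /stopping /running /=.
have := @reached_mono R alpha n s _ f k k.+1 (leqnSn k).
by case: (reached _ _ _ k) => [->//|_]; rewrite ?subrr ?andbT//;
   case: reached; rewrite /= ?subr0 ?subrr.
Qed.

Lemma prob_T_eqE (R : realType) (alpha : R) (n r s k : nat) :
  prob_T_eq alpha n r s k = avg (histories n r k) (fun f => stopping alpha s f).
Proof.
rewrite /prob_T_eq /avg -sum1dep_card natr_sum big_mkcondr /=.
by congr (_ / _); apply: eq_bigr => f _; rewrite /stopping; case: ifP.
Qed.

(** The indicator at time [k] is determined by the first [k] rounds, so it factors out of the
    average over the last one. *)
Lemma avg_running_recr (R : realType) (alpha : R) (n r s k : nat)
    (F : {ffun 'I_k.+1 -> {set 'I_n}} -> R) :
  avg (histories n r k.+1) (fun f => running alpha s f k * F f) =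
  avg (histories n r k) (fun f =>
    running alpha s f k * avg (rsets n r) (fun H => F (snoc f H))).
Proof.
rewrite avg_histories_recr; apply: eq_avg => f _ /=.
by rewrite -avgZ; apply: eq_avg => H _; rewrite /running reached_snoc.
Qed.

Lemma prob_T_eqS (R : realType) (alpha : R) (n r s k : nat) : (r <= n)%N ->
  prob_T_eq alpha n r s k.+1 = tail alpha n r s k - tail alpha n r s k.+1.
Proof.
(* The factor 1 fits [avg_running_recr], which averages out the last round and brings the first term
   back to histories of length [k]. *)
move=> rn; rewrite prob_T_eqE (eq_avg (G := fun f => running alpha s f k * 1 -
  running alpha s f k.+1)); last by move=> f _; rewrite stoppingS mulr1.
rewrite avgB avg_running_recr; congr (_ - _); apply: eq_avg => f _.
by rewrite avg_cst ?mulr1 // card_rsets bin_gt0.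
Qed.

(** The lower bound is weakened from ln alpha to ln (alpha - p), to share one [lo] with the stopped
    paths in [stopped_potential_bounds]. *)
Lemma running_potential_bounds (R : realType) (n r s k : nat) (alpha p : R)
    (f : {ffun 'I_k -> {set 'I_n}}) :
  (s <= r)%N -> (r <= n)%N -> p = 'C(r, s)%:R / 'C(n, s)%:R ->
  0 < alpha -> p < alpha ->
  ln (alpha - p) * running alpha s f k <=
    running alpha s f k * potential R s f <= 0.
Proof.
move=> sr rn pE alpha0 pa.
rewrite /running; case: (boolP (reached _ _ _ _)) => [_|] /=.
  by rewrite mulr0 mul0r lexx.
rewrite mulr1 mul1r reachedNE => cN.
have N0 : 0 < ('C(n, s)%:R : R) by rewrite ltr0n bin_gt0 (leq_trans sr).
have p0 : 0 < p by rewrite pE divr_gt0// ltr0n bin_gt0.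
have c0 : 0 < (#|uncollected s f k|%:R : R) by apply: lt_trans cN; rewrite mulr_gt0.
rewrite /potential ler_ln ?posrE ?subr_gt0 ?divr_gt0// ler_pdivlMr//.
rewrite ln_le0 ?andbT; last first.
  by rewrite ler_pdivrMr// mul1r ler_nat -(card_uncollected s f k) leq_addl.
by rewrite (le_trans _ (ltW cN))// ler_wpM2r ?ltW// gtrBl.
Qed.

(** Control of the overshoot: just before stopping the uncollected fraction exceeds alpha, and one
    round removes at most [p] of it. *)
Lemma stopping_potential_bounds (R : realType) (n r s k : nat) (alpha p : R)
    (f : {ffun 'I_k -> {set 'I_n}}) (H : {set 'I_n}) :
  (s <= r)%N -> (r <= n)%N -> p = 'C(r, s)%:R / 'C(n, s)%:R ->
  0 < alpha -> p < alpha -> H \in rsets n r ->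
  ln (alpha - p) * stopping alpha s (snoc f H) <=
    stopping alpha s (snoc f H) * potential R s (snoc f H) <=
  ln alpha * stopping alpha s (snoc f H).
Proof.
move=> sr rn pE alpha0 pa Hr.
rewrite /stopping -pred_Sn reached_snoc.
case: (boolP (reached _ _ (snoc _ _) _)) => [|_] /=; last first.
  by rewrite !mulr0 mul0r lexx.
case: (boolP (reached _ _ f _)) => [|] /=; first by rewrite !mulr0 mul0r lexx.
rewrite !mulr1 mul1r reachedNE -[reached _ _ _ _]negbK reachedNE -leNgt => c2 c1.
have N0 : 0 < ('C(n, s)%:R : R) by rewrite ltr0n bin_gt0 (leq_trans sr).
have d1 : #|newly_collected s f H|%:R <= p * 'C(n, s)%:R.
  by rewrite pE divfK ?gt_eqF// ler_nat (card_newly_collected_le _ _ Hr).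
have c1' : (alpha - p) * 'C(n, s)%:R <= #|uncollected s (snoc f H) k.+1|%:R.
  by rewrite card_uncollected_snoc; lra.
have c0 : 0 < (#|uncollected s (snoc f H) k.+1|%:R : R).
  by apply: lt_le_trans c1'; rewrite mulr_gt0 ?subr_gt0.
rewrite /potential !ler_ln ?posrE ?subr_gt0 ?divr_gt0//.
by rewrite ler_pdivlMr// ler_pdivrMr// c1'.
Qed.

(** * Two-sided bounds on the expectation for fixed [n] *)

Lemma expect_T_bounds (R : realType) (n r s : nat) (alpha p : R) :
  (s <= r)%N -> (r <= n)%N -> p = 'C(r, s)%:R / 'C(n, s)%:R ->
  0 < alpha -> alpha < 1 -> p < alpha ->
  ((((1 - p / alpha) * ln alpha^-1 / p)%:E <= expect_T alpha n r s) &&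
   (expect_T alpha n r s <= (- ln (alpha - p) / p)%:E))%E.
Proof.
move=> sr rn pE alpha0 alpha1 pa.
have N0 : 0 < ('C(n, s)%:R : R) by rewrite ltr0n bin_gt0 (leq_trans sr).
have p0 : 0 < p by rewrite pE divr_gt0// ltr0n bin_gt0.
have h0 : (0 < #|rsets n r|)%N by rewrite card_rsets bin_gt0.
have pa1 : 0 < 1 - p / alpha by rewrite subr_gt0 ltr_pdivrMr// mul1r.
have hk0 k : (0 < #|histories n r k|)%N by rewrite card_histories expn_gt0 h0.
have unc0 (f : {ffun 'I_0 -> {set 'I_n}}) : #|uncollected s f 0| = 'C(n, s).
  rewrite -(card_uncollected s f 0).
  suff -> : collected s f 0 = finset.set0 by rewrite cards0.
  by apply/setP => S; rewrite !inE; apply/negbTE/negP => /andP[_ /existsP[[]]].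
have run0 (f : {ffun 'I_0 -> {set 'I_n}}) : running alpha s f 0 = 1.
  by rewrite /running reachedNE unc0 gtr_pMl// alpha1.
set a := tail alpha n r s.
pose G k := avg (histories n r k) (fun f => running alpha s f k * potential R s f).
pose B k := avg (histories n r k) (fun f => stopping alpha s f * potential R s f).
have a0 : a 0%N = 1.
  by rewrite /a /tail (eq_avg (G := fun=> 1)) ?avg_cst// => f _; rewrite run0.
have G0 : G 0%N = 0.
  rewrite /G (eq_avg (G := fun=> 0)) ?avg_cst// => f _.
  by rewrite run0 mul1r /potential unc0 divff ?ln1// gt_eqF.
have step k : - ((1 - p / alpha)^-1 * p) * a k <= G k.+1 + B k.+1 - G k <= - p * a k.
  (* A path running at time [k] is, one round later, either running or just stopped, so the two
     indicators add up to the earlier one and only the drift on running paths remains. *)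
  have -> : G k.+1 + B k.+1 - G k = avg (histories n r k) (fun f => running alpha s f k *
      (avg (rsets n r) (fun H => potential R s (snoc f H)) - potential R s f)).
    rewrite /G /B -avgD (eq_avg (G := fun f => running alpha s f k * potential R s f)).
      by rewrite avg_running_recr -avgB; apply: eq_avg => f _; rewrite mulrBr.
    by move=> f _; rewrite stoppingS -mulrDl subrKC.
  rewrite /a /tail -!avgZ; apply/andP; split; apply: avg_le => f _;
    rewrite [_ * running _ _ _ _]mulrC /running;
    (case: (boolP (reached _ _ _ _)) => [_|nr] /=; first by rewrite !mul0r);
    by rewrite !mul1r; have /andP[] := avg_potential_drift sr rn pE alpha0 pa nr.
have stop k : ln (alpha - p) * (a k - a k.+1) <= B k.+1 <= ln alpha * (a k - a k.+1).
  rewrite -prob_T_eqS// prob_T_eqE -!avgZ /B !avg_histories_recr.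
  apply/andP; split; apply: avg_le => f _; apply: avg_le => H Hr;
  by have /andP[] := stopping_potential_bounds f sr rn pE alpha0 pa Hr.
have run k : ln (alpha - p) * a k <= G k <= 0.
  rewrite /a /tail /G -avgZ -[X in _ <= _ <= X](avg_cst _ (hk0 k)).
  apply/andP; split; apply: avg_le => f _;
  by have /andP[] := running_potential_bounds f sr rn pE alpha0 pa.
have bnd := stopped_potential_bounds a0 G0 step stop run.
have la0 : 0 <= ln alpha^-1 by rewrite ln_ge0// invf_ge1// ltW.
apply: (@expectation_bounds _ a) => //.
- by move=> k; apply: avg_ge0 => f; rewrite /running ler0n.
- by move=> k; rewrite divr_ge0.
(* At time 0 the predecessor is again 0, so the stopping event contradicts itself. *)
- rewrite prob_T_eqE (eq_avg (G := fun=> 0)) ?avg_cst// => f _.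
  by rewrite /stopping /= andbN.
- by move=> k; rewrite prob_T_eqS.
- by rewrite divr_ge0 ?mulr_ge0// ltW.
move=> K; have [up lo] := bnd K; apply/andP; split.
  move: lo; rewrite -lnV ?posrE//.
  (* With q = 1 - p / alpha, the bound is divided by the maximal drift rate p / q. *)
  move: (\sum_(0 <= k < K) a k) (1 - p / alpha) pa1 => S q q0 lo.
  have -> : S = q / p * (q^-1 * p * S) by field; rewrite !gt_eqF.
  have -> : q * ln alpha^-1 / p * (1 - a K) = q / p * (ln alpha^-1 * (1 - a K)).
    by ring.
  by rewrite ler_wpM2l// divr_ge0// ltW.
by rewrite ler_pdivlMr// mulrC.
Qed.

(** * Asymptotics as [n] grows *)

Lemma subn_le_bin (n s : nat) : (1 <= s)%N -> (n - s <= 'C(n, s))%N.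
Proof.
case: s => // s _; elim: n => [|n IH]//.
have [ns|sn] := leqP n s; first by rewrite subSS (eqP ns).
rewrite binS subSn//; apply: leq_trans (leq_add IH (_ : (1 <= 'C(n, s))%N)).
  by rewrite addn1.
by rewrite bin_gt0 ltnW.
Qed.

(** The crude linear bound [subn_le_bin] already drives C(n, s) to infinity. *)
Lemma cvg_inv_bin (R : realType) (s : nat) : (1 <= s)%N ->
  (fun n => ('C(n, s)%:R)^-1 : R) @ \oo --> (0 : R).
Proof.
move=> s1; apply/(gtr0_cvgV0 (f := fun n => 'C(n, s)%:R)).
  by near=> n; rewrite ltr0n bin_gt0; near: n; exact: nbhs_infty_ge.
apply/cvgrnyP; apply/cvgnyPge => A; near=> n.
apply: leq_trans (subn_le_bin n s1); rewrite -(addnK s A).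
by apply: leq_sub2r; near: n; exact: nbhs_infty_ge.
Unshelve. all: by end_near. Qed.

Theorem theorem2 (R : realType) (r s : nat) (alpha : R) :
  (1 <= s)%N -> (s <= r)%N -> 0 < alpha -> alpha < 1 ->
  (\forall n \near \oo, (expect_T alpha n r s < +oo)%E) /\
  ((fun n : nat => fine (expect_T alpha n r s) /
     (('C(n, s))%:R * ln (alpha^-1) / ('C(r, s))%:R)) @ \oo --> (1 : R)).
Proof.
move=> s1 sr alpha0 alpha1.
pose p n : R := 'C(r, s)%:R / 'C(n, s)%:R.
have L0 : 0 < ln alpha^-1 by rewrite ln_gt0// invf_gt1.
have p_cvg : p @ \oo --> (0 : R).
  rewrite -[0](mulr0 ('C(r, s)%:R : R)).
  by apply: cvgM; [exact: cvg_cst | exact: cvg_inv_bin].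
have p_lt : \forall n \near \oo, p n < alpha by apply: cvgr_lt p_cvg _ _.
have bounds : \forall n \near \oo,
    (((1 - p n / alpha) * ln alpha^-1 / p n)%:E <= expect_T alpha n r s)%E /\
    (expect_T alpha n r s <= (- ln (alpha - p n) / p n)%:E)%E.
  near=> n; apply/andP; apply: expect_T_bounds => //; near: n => //.
  exact: nbhs_infty_ge.
split.
  by apply: filterS bounds => n [_ up]; exact: le_lt_trans up (ltry _).
(* Divided by ln (1 / alpha) / p, the two bounds become 1 - p / alpha and - ln (alpha - p) / ln (1 /
   alpha); both tend to 1, the second by continuity of ln at alpha. *)
have lowc : (fun n => 1 - p n / alpha) @ \oo --> (1 : R).
  rewrite -[X in _ --> X]subr0 -[X in _ - X](mul0r alpha^-1).
  by apply: cvgB; [exact: cvg_cst | apply: cvgM => //; exact: cvg_cst].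
have upc : (fun n => - ln (alpha - p n) / ln alpha^-1) @ \oo --> (1 : R).
  have E : - ln alpha / ln alpha^-1 = 1 by rewrite -lnV ?posrE// divff ?gt_eqF.
  rewrite -E.
  apply: cvgM; last exact: cvg_cst.
  apply: cvgN; apply: continuous_cvg; first exact: continuous_ln.
  by rewrite -[X in _ --> X]subr0; apply: cvgB => //; exact: cvg_cst.
apply: squeeze_cvgr lowc upc.
apply: filterS2 bounds (nbhs_infty_ge r) => n [lo up] /= rn.
have N0 : 0 < ('C(n, s)%:R : R) by rewrite ltr0n bin_gt0 (leq_trans sr).
have M0 : 0 < ('C(r, s)%:R : R) by rewrite ltr0n bin_gt0.
have p0 : 0 < p n by rewrite divr_gt0.
(* [fine] sends infinities to 0, so finiteness comes before reading the bounds in [R]. *)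
have Tfin : expect_T alpha n r s \is a fin_num.
  by rewrite fin_numElt (lt_le_trans _ lo) ?ltNyr// (le_lt_trans up) ?ltry.
move: lo up; rewrite -(fineK Tfin) !lee_fin => lo up.
have -> : 'C(n, s)%:R * ln alpha^-1 / 'C(r, s)%:R = ln alpha^-1 / p n.
  by rewrite /p; field; rewrite !gt_eqF.
rewrite invf_div mulrA; apply/andP; split.
  rewrite ler_pdivlMr// -ler_pdivrMr//.
by rewrite ler_pM2r ?invr_gt0// -ler_pdivlMr.
Unshelve. all: by end_near. Qed.
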